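(* If $n\ge 3$, then $\mathrm{mob}(C_n\odot K_1)=\left\lceil n/2\right\rceil+1$.
   Context: $C_n$ is the cycle on $n$ vertices. For graphs $G$ with $V(G)=\{v_1,\dots,v_n\}$ and $H$, the corona product $G\odot H$ is obtained from one copy of $G$ and $n$ disjoint copies $H^1,\dots,H^n$ of $H$ by joining $v_i$ to every vertex of $H^i$ (so $C_n\odot K_1$ is $C_n$ with one pendant leaf attached to each vertex). A set $S\subseteq V(G)$ is a general position set if no three vertices of $S$ lie on a common shortest path. Robots are placed one per vertex of a general position set $S$; a move $u\to v$ along an edge $uv$ with $u\in S$ is legal if $v\notin S$ and $(S\setminus\{u\})\cup\{v\}$ is a general position set. $S$ is a mobile general position set if some sequence of legal moves starting from $S$ visits every vertex at least once; $\mathrm{mob}(G)$ is the maximum size of a mobile general position set. *)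

(* Defs.v *)
From HB Require Import structures.
From mathcomp Require Import all_boot.
From mathcomp Require Import boolp.

Set Implicit Arguments.
Unset Strict Implicit.
Unset Printing Implicit Defensive.

Record sgraph := SGraph {
  vertex :> finType;
  adj : rel vertex;
  adj_sym : symmetric adj;
  adj_irr : irreflexive adj }.

Section CycleGraph.
Variable n : nat.

(* The conjunct i != j only matters for n = 1, where it removes the loop. *)
Definition cycle_adj : rel 'I_n :=
  [rel i j | (i != j) && ((j == ordS i) || (i == ordS j))].

Lemma cycle_adj_sym : symmetric cycle_adj.
Proof. by move=> i j; rewrite /cycle_adj /= eq_sym orbC. Qed.

Lemma cycle_adj_irr : irreflexive cycle_adj.
Proof. by move=> i; rewrite /cycle_adj /= eqxx. Qed.

Definition cycle_graph : sgraph := SGraph cycle_adj_sym cycle_adj_irr.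
End CycleGraph.

Section CompleteGraph.
Variable n : nat.

Definition complete_adj : rel 'I_n := [rel i j | i != j].

Lemma complete_adj_sym : symmetric complete_adj.
Proof. by move=> i j; rewrite /complete_adj /= eq_sym. Qed.

Lemma complete_adj_irr : irreflexive complete_adj.
Proof. by move=> i; rewrite /complete_adj /= eqxx. Qed.

Definition complete_graph : sgraph := SGraph complete_adj_sym complete_adj_irr.
End CompleteGraph.

Section Corona.
Variables G H : sgraph.

(* inl v is the vertex v of G; inr (v, h) is the vertex h of the copy of H
   attached to v. *)
Definition corona_adj : rel (G + G * H)%type :=
  fun x y => match x, y with
  | inl u, inl v => adj u v
  | inl u, inr (v, _) => u == v
  | inr (u, _), inl v => u == v
  | inr (u, h), inr (v, k) => (u == v) && adj h k
  end.

Lemma corona_adj_sym : symmetric corona_adj.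
Proof.
by case=> [u|[u h]] [v|[v k]] /=; rewrite 1?adj_sym 1?(eq_sym u).
Qed.

Lemma corona_adj_irr : irreflexive corona_adj.
Proof. by case=> [u|[u h]] /=; rewrite adj_irr ?andbF. Qed.

Definition corona : sgraph := SGraph corona_adj_sym corona_adj_irr.
End Corona.

Section GeneralPosition.
Variable G : sgraph.
Implicit Types (S A B : {set G}).

(* x :: p is a shortest path from x to last x p. *)
Definition shortest_path (x : G) (p : seq G) : Prop :=
  path (@adj G) x p /\
  forall q, path (@adj G) x q -> last x q = last x p -> size p <= size q.

Definition general_position S : Prop :=
  forall a b c, a \in S -> b \in S -> c \in S -> uniq [:: a; b; c] ->
  ~ exists x p, shortest_path x p /\ {subset [:: a; b; c] <= x :: p}.

Definition legal_move A B : Prop :=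
  exists u v, [/\ u \in A, v \notin A, adj u v, B = v |: (A :\ u)
                & general_position B].

(* The initial configuration counts towards the visited vertices. *)
Definition mobile_general_position S : Prop :=
  general_position S /\
  exists Ss : seq {set G},
    path (fun A B => `[< legal_move A B >]) S Ss /\
    forall v : G, exists2 A, A \in S :: Ss & v \in A.

Definition mob : nat :=
  \max_(S : {set G} | `[< mobile_general_position S >]) #|S|.
End GeneralPosition.

(* Main.v *)
Require Import Defs.
From mathcomp Require Import all_boot.
From mathcomp Require Import boolp zify.

Set Implicit Arguments.
Unset Strict Implicit.
Unset Printing Implicit Defensive.

(** If a general position set with at least three robots contains the cycle
vertex at position 0, all robots have distinct positions, and the remaining
positions pairwise differ by less than n/2, since otherwise a geodesic joining
two of them runs through 0. So they fit in a window of ceil(n/2) consecutive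
positions, which gives the upper bound.

Conversely, put robots on the leaves of a window of ceil(n/2) consecutive
positions and one more robot on a cycle vertex outside the window. That robot
walks around the cycle to the far end of the window and steps down onto a leaf;
then the robot at the near end of the window steps up onto the cycle. This
rotates the configuration by one position, and repeating it visits every
vertex. *)

(** * General position in terms of graph distance *)

Section GraphMetric.
Variables (G : sgraph) (d : G -> G -> nat).

(** Local conditions that force [d] to be the graph distance: an edge changes [d] by at most one,
    and some neighbour of [x] is closer to [y] by exactly one. *)
Definition graph_metric : Prop :=
  [/\ forall x, d x x = 0, forall x y, d x y = d y x,
      forall x y z, adj x y -> d x z <= (d y z).+1
    & forall x y, x != y -> exists2 z, adj x z & d x y = (d z y).+1].

Hypothesis dP : graph_metric.

Lemma metric_triangle x y z : d x z <= d x y + d y z.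
Proof.
case: dP => d0 _ lip step.
move dxy: (d x y) => k; elim: k x dxy => [|k IH] x dxy.
  by have [->|/step[? _]] := eqVneq x y; [rewrite add0n|rewrite dxy].
have [xy|/step[t xt]] := eqVneq x y; first by move: dxy; rewrite xy d0.
rewrite dxy => -[/esym/IH]; have := lip _ _ z xt; lia.
Qed.

Lemma metric_path x y :
  exists p, [/\ path (@adj G) x p, last x p = y & size p = d x y].
Proof.
case: dP => d0 _ _ step.
move dxy: (d x y) => k; elim: k x dxy => [|k IH] x dxy;
  have [xy|/step[t xt]] := eqVneq x y; rewrite ?dxy //.
- by exists [::].
- by move: dxy; rewrite xy d0.
case=> /esym/IH[p [tp lp sp]].
by exists (t :: p); split; rewrite /= ?xt ?sp.
Qed.

Lemma metric_nth_le x p i j : path (@adj G) x p -> i <= j <= size p ->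
  d (nth x (x :: p) i) (nth x (x :: p) j) <= j - i.
Proof.
case: dP => d0 dC lip _ /(pathP x) xp /andP[/subnK <-].
elim: (j - i) => [|t IH]; first by rewrite d0.
rewrite addSn => ti; rewrite dC /=.
apply: leq_trans (lip _ (nth x (x :: p) (t + i)) _ _) _.
  by rewrite adj_sym; apply: xp.
by have := IH (ltnW ti); rewrite dC; lia.
Qed.

(** The points at [i] and [j] cut the path into three pieces, each at least as long as the distance
    of its ends. By the triangle inequality a strict inequality anywhere would make the whole path
    longer than the distance of its ends. *)
Lemma shortest_path_nth x p i j : shortest_path x p -> i <= j <= size p ->
  d (nth x (x :: p) i) (nth x (x :: p) j) = j - i.
Proof.
case=> xp short /andP[ij jp].
have [q [xq lq sq]] := metric_path x (last x p).
have := short q xq lq; rewrite sq (last_nth x) => le_d.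
have := metric_triangle x (nth x (x :: p) i) (nth x (x :: p) (size p)).
have := metric_triangle (nth x (x :: p) i) (nth x (x :: p) j)
  (nth x (x :: p) (size p)).
have := @metric_nth_le x p 0 i xp; have := @metric_nth_le x p i j xp.
have := @metric_nth_le x p j (size p) xp.
rewrite ij jp leqnn (leq_trans ij jp) /= => /(_ isT) ? /(_ isT) ? /(_ isT) ?.
lia.
Qed.

(** If distances add up at [b], geodesics from [a] to [b] and from [b] to [c] concatenate to a
    shortest path. Conversely, distances along a shortest path are index differences, so they add up
    at the middle vertex. *)
Lemma general_positionP (S : {set G}) : general_position S <->
  (forall a b c, a \in S -> b \in S -> c \in S -> uniq [:: a; b; c] ->
   d a b + d b c <> d a c).
Proof.
have [d0 dC lip _] := dP; split=> gp a b c aS bS cS abc.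
  move=> dabc; apply: (gp _ _ _ aS bS cS abc).
  have [p [ap lp sp]] := metric_path a b; have [q [bq lq sq]] := metric_path b c.
  exists a, (p ++ q); split; first split.
  - by rewrite cat_path ap lp.
  - move=> r ar; rewrite last_cat lp lq size_cat sp sq dabc => <-.
    have := @metric_nth_le a r 0 (size r) ar.
    by rewrite leqnn subn0 -last_nth; apply.
  - move=> z; rewrite -cat_cons mem_cat !inE -lq -lp => /or3P[]/eqP->.
    + by rewrite eqxx.
    + by rewrite -in_cons mem_last.
    + by have := mem_last (last a p) q; rewrite inE => /orP[/eqP->|->];
        rewrite -?in_cons ?mem_last ?orbT.
case=> x [p [short sub]].
(* The sum of the two truncated differences is the absolute difference of the indices. *)
have dist y z : y \in x :: p -> z \in x :: p ->
    d y z = (index y (x :: p) - index z (x :: p))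
            + (index z (x :: p) - index y (x :: p)).
  move=> yp zp; rewrite -{1}(nth_index x yp) -{1}(nth_index x zp).
  move: yp zp; rewrite -!index_mem ![_ < size _]ltnS.
  move: (index y _) (index z _) => i j ip jp.
  have [ij|/ltnW ji] := leqP i j.
    by rewrite (shortest_path_nth short) ?ij //; lia.
  by rewrite dC (shortest_path_nth short) ?ji //; lia.
have [ap bp cp] : [/\ a \in x :: p, b \in x :: p & c \in x :: p].
  by split; apply: sub; rewrite !inE eqxx ?orbT.
(* Any of the three vertices may be the middle one on the path, so the hypothesis is used in three
   orders. *)
have [bac acb] : uniq [:: b; a; c] /\ uniq [:: a; c; b].
  move: abc; rewrite /= !inE !negb_or !andbT (eq_sym b a) (eq_sym c b).
  by move=> /andP[/andP[-> ->] ->].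
have := gp _ _ _ aS bS cS abc; have := gp _ _ _ bS aS cS bac.
have := gp _ _ _ aS cS bS acb; rewrite !dist //; lia.
Qed.

End GraphMetric.

(** * Invariants of legal moves *)

Lemma card_legal_move (G : sgraph) (A B : {set G}) :
  legal_move A B -> #|B| = #|A|.
Proof.
case=> u [v [uA vA _ -> _]].
by rewrite cardsU1 (cardsD1 u A) uA !inE (negPf vA) andbF.
Qed.

Lemma legal_path_inv (G : sgraph) (S A : {set G}) Ss : general_position S ->
  path (fun A B => `[< legal_move A B >]) S Ss -> A \in S :: Ss ->
  general_position A /\ #|A| = #|S|.
Proof.
elim: Ss S => [|B Ss IH] S gpS /=; first by move=> _; rewrite inE => /eqP->.
case/andP=> /asboolP SB BSs; rewrite inE => /predU1P[->//|].
have [? [? [_ _ _ _ gpB]]] := SB.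
by move/(IH _ gpB BSs); rewrite (card_legal_move SB).
Qed.

(** * The distance function of the sun graph *)

Section SunGraph.
Variable n : nat.
Hypothesis n_ge3 : 3 <= n.

Local Notation sun := (corona (cycle_graph n) (complete_graph 1)).

Definition position (x : sun) : nat :=
  match x with inl i => nat_of_ord (i : 'I_n) | inr (i, _) => nat_of_ord (i : 'I_n) end.

Definition is_leaf (x : sun) : bool := if x is inr _ then true else false.

Definition cycle_dist (i j : nat) : nat :=
  minn ((i - j) + (j - i)) (n - ((i - j) + (j - i))).

(** Each leaf end adds one step to the distance along the cycle; equality is separate because the
    formula would put a leaf at distance 2 from itself. *)
Definition sun_dist (x y : sun) : nat :=
  if x == y then 0 else cycle_dist (position x) (position y) + is_leaf x + is_leaf y.

Lemma position_lt x : position x < n.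
Proof. by case: x => [i|[i h]]; apply: ltn_ord. Qed.

Lemma sun_vertex_inj x y :
  position x = position y -> is_leaf x = is_leaf y -> x = y.
Proof.
by case: x y => [i|[i h]] [j|[j k]] //= /val_inj-> // _; rewrite (ord1 h) (ord1 k).
Qed.

Lemma sun_eqE (x y : sun) :
  (x == y) = (is_leaf x == is_leaf y) && (position x == position y).
Proof.
apply/eqP/andP=> [->|[/eqP ? /eqP ?]]; last exact: sun_vertex_inj.
by rewrite !eqxx.
Qed.

Lemma leaf_adj (u v : sun) :
  is_leaf u != is_leaf v -> position u = position v -> adj u v.
Proof. by case: u v => [i|[i h]] [j|[j k]] //= _ /val_inj->. Qed.

Lemma sun_dist_cycle x y : ~~ is_leaf x ->
  sun_dist x y = cycle_dist (position x) (position y) + is_leaf y.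
Proof.
move=> xl; rewrite /sun_dist (negPf xl) addn0; case: eqP => // <-.
by rewrite (negPf xl) /cycle_dist; lia.
Qed.

Lemma val_ordS (i : 'I_n) : ordS i = (if i.+1 == n then 0 else i.+1) :> nat.
Proof.
rewrite /=; case: eqP => [->|ne]; first by rewrite modnn.
by rewrite modn_small //; have := ltn_ord i; lia.
Qed.

Lemma cycle_adjE (i j : 'I_n) : @adj sun (inl i) (inl j) =
  [|| j == i.+1 :> nat, i == j.+1 :> nat, (i == 0 :> nat) && (j == n.-1 :> nat)
    | (j == 0 :> nat) && (i == n.-1 :> nat)].
Proof.
have natE (a b : 'I_n) : (a == b) = (a == b :> nat) by [].
rewrite /= /cycle_adj [LHS]/= !natE !val_ordS.
by have := ltn_ord i; have := ltn_ord j; do 2?case: ifP => /eqP; lia.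
Qed.

Lemma sun_metric : graph_metric sun_dist.
Proof.
have dC x y : sun_dist x y = sun_dist y x.
  by rewrite /sun_dist eq_sym /cycle_dist; case: ifP => // _; lia.
split=> //.
- by move=> x; rewrite /sun_dist eqxx.
- case=> [i|[i h]] [j|[j k]] z.
  + rewrite cycle_adjE !sun_dist_cycle //= /cycle_dist.
    have := ltn_ord i; have := ltn_ord j; have := position_lt z; lia.
  + move=> /= /eqP->; rewrite sun_dist_cycle // /sun_dist /cycle_dist /=.
    by case: eqP => [<-|] /=; lia.
  + move=> /= /eqP->; rewrite [X in _ <= X.+1]sun_dist_cycle //.
    by rewrite /sun_dist; case: eqP => //= _; lia.
  + by rewrite /= (ord1 h) (ord1 k) andbF.
case=> [i|[i h]] y xy.
  have [yi|yi] := eqVneq (position y) i.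
    have yl : is_leaf y by move: xy; rewrite sun_eqE /= yi eqxx andbT; case: is_leaf.
    exists y; first by apply: leaf_adj; rewrite ?yl.
    by rewrite sun_dist_cycle // /sun_dist eqxx /= yi yl /cycle_dist /=; lia.
  have := ltn_ord i; have := position_lt y => yn lt_in.
  have [j ij dj] : exists2 j : 'I_n, @adj sun (inl i) (inl j)
      & cycle_dist i (position y) = (cycle_dist j (position y)).+1.
    have n1 : n.-1 < n by lia.
    have n0 : 0 < n by lia.
    pose up := if i.+1 == n then 0 else i.+1.
    pose down := if i == 0 :> nat then n.-1 else i.-1.
    have up_n : up < n by rewrite /up; case: eqP; lia.
    have down_n : down < n by rewrite /down; case: eqP; lia.
    (* At least one of the two cycle neighbours is nearer to [y]: if [up] is not, [down] is. *)
    case: (boolP (cycle_dist i (position y) == (cycle_dist up (position y)).+1)) => [/eqP E|E].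
      by exists (Ordinal up_n) => //; rewrite cycle_adjE /= /up; case: ifP => /eqP; lia.
    exists (Ordinal down_n); first by rewrite cycle_adjE /= /down; case: ifP => /eqP; lia.
    move: E; rewrite /= /up /down /cycle_dist; do 2?case: ifP => /eqP; lia.
  by exists (inl j) => //; rewrite !sun_dist_cycle // dj addSn.
exists (inl i); first exact: eqxx.
rewrite (@sun_dist_cycle (inl i)) // /sun_dist (negPf xy) /=; lia.
Qed.

(** * The upper bound *)

(** A geodesic from a leaf to any third robot passes through the cycle vertex below that leaf. *)
Lemma general_position_inj (S : {set sun}) : general_position S -> 2 < #|S| ->
  {in S &, injective position}.
Proof.
move=> /(general_positionP sun_metric) gp S3.
have aux x y : x \in S -> y \in S -> is_leaf x -> ~~ is_leaf y ->
    position x = position y -> False.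
  move=> xS yS xl yl xy; have xny : x != y by apply: contraTneq xl => ->.
  have /card_gt0P[z] : 0 < #|S :\ x :\ y|.
    by move: S3; rewrite (cardsD1 x) xS (cardsD1 y (S :\ x)) !inE yS eq_sym xny; lia.
  rewrite !inE => /and3P[zy zx zS].
  apply: (gp x y z) => //; first by rewrite /= !inE negb_or xny (eq_sym x) zx eq_sym zy.
  rewrite (@sun_dist_cycle y) // /sun_dist (negPf xny) eq_sym (negPf zx) xl xy.
  by rewrite (negPf yl) /cycle_dist; lia.
move=> x y xS yS xy; apply: sun_vertex_inj => //.
case xl: (is_leaf x); case yl: (is_leaf y) => //; exfalso.
  by apply: (aux x y); rewrite ?xl ?yl.
by apply: (aux y x); rewrite ?xl ?yl.
Qed.

Lemma card_general_position (S : {set sun}) x : general_position S ->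
  x \in S -> ~~ is_leaf x -> position x = 0 -> #|S| <= uphalf n + 1.
Proof.
move=> gpS xS xl x0; have [S3|] := ltnP 2 #|S|; last by lia.
have inj := general_position_inj gpS S3.
(* At a gap of at least [uphalf n], the arc through 0 is a shortest one, so distances add up at
   [x]. *)
have window y z : y \in S :\ x -> z \in S :\ x -> position y <= position z ->
    position z < position y + uphalf n.
  rewrite !inE => /andP[yx yS] /andP[zx zS] le_yz; rewrite ltnNge; apply/negP => far.
  have yz : y != z by apply/eqP => yz; move: far; rewrite yz; lia.
  move/(general_positionP sun_metric): gpS => /(_ y x z yS xS zS).
  apply; first by rewrite /= !inE negb_or yx yz eq_sym zx.
  have [_ dC _ _] := sun_metric.
  rewrite (dC y x) !(sun_dist_cycle _ xl) /sun_dist (negPf yz) x0 /cycle_dist.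
  have := position_lt y; have := position_lt z; lia.
have /card_gt0P[y0 y0S] : 0 < #|S :\ x| by move: S3; rewrite (cardsD1 x S) xS; lia.
(* The window starts at the least position in [S :\ x]. *)
case: (@arg_minnP _ y0 (mem (S :\ x)) position y0S) => y yS ymin.
rewrite (cardsD1 x S) xS addnC leq_add2r cardE -(size_map position).
rewrite -[uphalf n](size_iota (position y)); apply: uniq_leq_size.
  rewrite map_inj_in_uniq ?enum_uniq // => a b.
  by rewrite !mem_enum !inE => /andP[_ aS] /andP[_ bS]; apply: inj.
move=> _ /mapP[z + ->]; rewrite mem_enum mem_iota => zS.
by rewrite ymin // window // ymin.
Qed.

(** Some configuration on the route occupies the cycle vertex 0, and moves preserve general position
    and size. *)
Lemma mobile_card_le (S : {set sun}) :
  mobile_general_position S -> #|S| <= uphalf n + 1.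
Proof.
have n0 : 0 < n by lia.
case=> gpS [Ss [SSs visit]].
have [A ASs A0] := visit (inl (Ordinal n0)).
have [gpA <-] := legal_path_inv gpS SSs ASs.
exact: card_general_position gpA A0 _ _.
Qed.

(** * Window configurations for the lower bound *)

Definition offset (w i : nat) : nat := if w <= i then i - w else i + n - w.

Lemma offsetE w i : w < n -> i < n ->
  (w <= i /\ i = w + offset w i) \/ (i < w /\ i + n = w + offset w i).
Proof. by move=> wn i_n; rewrite /offset; case: leqP; lia. Qed.

(* Robots on the leaves at offset less than [s] from [w] and on the cycle
   vertex at offset [t]; there is no cycle vertex when [t = n]. *)
Definition config (w s t : nat) : {set sun} :=
  [set x | if is_leaf x then offset w (position x) < s
           else offset w (position x) == t].

Lemma cycle_dist_triangle i j k : i < n -> j < n -> k < n ->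
  cycle_dist i k <= cycle_dist i j + cycle_dist j k.
Proof. by rewrite /cycle_dist; lia. Qed.

Lemma cycle_dist_offset w i j : w < n -> i < n -> j < n ->
  cycle_dist (offset w i) (offset w j) = cycle_dist i j.
Proof.
move=> wn i_n jn; have := offsetE wn i_n; have := offsetE wn jn.
by rewrite /cycle_dist; lia.
Qed.

(** Two points of the window differ by less than n/2, so their only geodesic stays inside the window
    and misses [j]. *)
Lemma cycle_dist_window s i j k : i < s -> k < s -> s <= uphalf n ->
  s <= j -> j < n -> cycle_dist i k < cycle_dist i j + cycle_dist j k.
Proof. by rewrite /cycle_dist; lia. Qed.

(** A leaf [b] between [a] and [c] costs two extra steps. If [b] is the cycle robot, then [a] and
    [c] are leaves of the window, and the strict window inequality applies. *)
Lemma config_general_position w s t : w < n ->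
  (t == n) || (s <= uphalf n) && (s <= t) -> general_position (config w s t).
Proof.
move=> wn st; apply/(general_positionP sun_metric) => a b c.
rewrite !inE => aS bS cS; rewrite /= !inE negb_or andbT => /andP[/andP[ab ac] bc].
rewrite /sun_dist (negPf ab) (negPf ac) (negPf bc).
have := cycle_dist_triangle (position_lt a) (position_lt b) (position_lt c).
have off x : offset w (position x) < n.
  have := offsetE wn (position_lt x); have := position_lt x; lia.
have [bl|bl] := boolP (is_leaf b); first by lia.
move: bS; rewrite (negPf bl) => /eqP bt.
have leafP x : x \in config w s t -> x != b -> is_leaf x.
  rewrite inE sun_eqE (negPf bl); case: (is_leaf x) => //= /eqP xt /eqP[].
  have := offsetE wn (position_lt x); have := offsetE wn (position_lt b).
  have := position_lt x; have := position_lt b; lia.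
have al : is_leaf a by apply: leafP => //; rewrite inE.
have cl : is_leaf c by apply: leafP; rewrite ?inE // eq_sym.
move: aS cS; rewrite al cl => aS cS _.
have := off b; rewrite bt => tn.
have /andP[sm sb] : (s <= uphalf n) && (s <= t) by move: st; rewrite (ltn_eqF tn).
have := cycle_dist_window aS cS sm sb tn; rewrite -bt !cycle_dist_offset ?position_lt //.
lia.
Qed.

Lemma sun_vertex_at w t b : w < n -> t < n ->
  exists2 x : sun, is_leaf x = b & offset w (position x) = t.
Proof.
move=> wn tn; pose i := if w + t < n then w + t else w + t - n.
have lt_in : i < n by rewrite /i; case: ifP; lia.
exists (if b then inr (Ordinal lt_in, ord0) else inl (Ordinal lt_in)); case: b => //=;
  by have := offsetE wn lt_in; move: (offset w i) => o; rewrite /i; case: ifP; lia.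
Qed.

Lemma legal_move_config w s t w' s' t' (u v : sun) :
  w' < n -> (t' == n) || (s' <= uphalf n) && (s' <= t') ->
  u \in config w s t -> v \notin config w s t -> adj u v ->
  (forall x, (x \in config w' s' t') =
     (x == v) || (x != u) && (x \in config w s t)) ->
  legal_move (config w s t) (config w' s' t').
Proof.
move=> w'n st' uA vA uv B_E; exists u, v; split=> //.
  by apply/setP => x; rewrite B_E !inE.
exact: config_general_position.
Qed.

(** * Rotating the window by legal moves *)

Lemma config_walk w t : w < n -> uphalf n <= t -> t.+1 < n ->
  legal_move (config w (uphalf n) t.+1) (config w (uphalf n) t).
Proof.
move=> wn st tn.
have [u ul ut] := sun_vertex_at false wn tn.
have [v vl vt] := sun_vertex_at false wn (ltnW tn).
apply: (@legal_move_config _ _ _ _ _ _ u v) => //.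
- by rewrite leqnn st orbT.
- by rewrite inE ul ut.
- by rewrite inE vl vt; lia.
- have := offsetE wn (position_lt u); have := offsetE wn (position_lt v).
  case: u v ul vl ut vt => [i|//] [j|//] _ _; rewrite cycle_adjE /=.
  by have := ltn_ord i; have := ltn_ord j; lia.
move=> x; rewrite !inE !sun_eqE ul vl; case: (is_leaf x) => //=.
have := position_lt u; have := position_lt v.
have := offsetE wn (position_lt u); have := offsetE wn (position_lt v).
have := offsetE wn (position_lt x); have := position_lt x; lia.
Qed.

(** The window grows to [(uphalf n).+1] leaves, which is harmless while no robot is on the cycle. *)
Lemma config_descend w : w < n ->
  legal_move (config w (uphalf n) (uphalf n)) (config w (uphalf n).+1 n).
Proof.
move=> wn; have mn : uphalf n < n by lia.
have [u ul ut] := sun_vertex_at false wn mn.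
have [v vl vt] := sun_vertex_at true wn mn.
have uv : position u = position v.
  have := offsetE wn (position_lt u); have := offsetE wn (position_lt v).
  have := position_lt u; have := position_lt v; lia.
apply: (@legal_move_config _ _ _ _ _ _ u v) => //.
- by rewrite eqxx.
- by rewrite inE ul ut.
- by rewrite inE vl vt ltnn.
- by apply: leaf_adj; rewrite ?ul ?vl.
move=> x; rewrite !inE !sun_eqE ul vl.
have := position_lt u; have := position_lt v.
have := offsetE wn (position_lt u); have := offsetE wn (position_lt v).
have := offsetE wn (position_lt x); have := position_lt x.
by case: (is_leaf x) => /=; lia.
Qed.

(** Seen from [w.+1], the vacated position [w] has offset [n.-1], and the remaining leaf offsets
    drop by one. *)
Lemma config_ascend w : w.+1 < n ->
  legal_move (config w (uphalf n).+1 n) (config w.+1 (uphalf n) n.-1).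
Proof.
move=> w1n; have wn := ltnW w1n; have n0 : 0 < n by lia.
have [u ul ut] := sun_vertex_at true wn n0.
have [v vl vt] := sun_vertex_at false wn n0.
have uv : position u = position v.
  have := offsetE wn (position_lt u); have := offsetE wn (position_lt v).
  have := position_lt u; have := position_lt v; lia.
apply: (@legal_move_config _ _ _ _ _ _ u v) => //.
- by apply/orP; right; lia.
- by rewrite inE ul ut.
- by rewrite inE vl vt; lia.
- by apply: leaf_adj; rewrite ?ul ?vl.
move=> x; rewrite !inE !sun_eqE ul vl.
have := position_lt u; have := position_lt v.
have := offsetE wn (position_lt u); have := offsetE wn (position_lt v).
have := offsetE wn (position_lt x); have := offsetE w1n (position_lt x).
by have := position_lt x; case: (is_leaf x) => /=; lia.
Qed.

Local Notation legal := (fun A B : {set sun} => `[< legal_move A B >]).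

Lemma config_rotate w : w.+1 < n -> exists2 Ss,
  path legal (config w (uphalf n) n.-1) Ss
  & last (config w (uphalf n) n.-1) Ss = config w.+1 (uphalf n) n.-1.
Proof.
move=> w1n; have wn := ltnW w1n.
(* Induction on the number [k] of cycle steps left before the robot is next to the far end of the
   window. *)
have walk k : uphalf n + k < n -> exists2 Ss,
    path legal (config w (uphalf n) (uphalf n + k)) Ss
    & last (config w (uphalf n) (uphalf n + k)) Ss = config w.+1 (uphalf n) n.-1.
  elim: k => [|k IH] kn.
    rewrite addn0.
    exists [:: config w (uphalf n).+1 n; config w.+1 (uphalf n) n.-1] => //=.
    by apply/and3P; split=> //; apply/asboolP;
      [apply: config_descend|apply: config_ascend].
  rewrite addnS in kn *; have [Ss pSs lSs] := IH (ltnW kn).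
  exists (config w (uphalf n) (uphalf n + k) :: Ss) => //=.
  by rewrite pSs andbT; apply/asboolP; apply: config_walk; rewrite ?leq_addr.
have := walk (n.-1 - uphalf n); rewrite subnKC; last by lia.
by apply; lia.
Qed.

(** The last clause keeps all intermediate window positions, from which every vertex is seen to be
    visited. *)
Lemma config_tour w : w < n -> exists Ss,
  [/\ path legal (config 0 (uphalf n) n.-1) Ss,
      last (config 0 (uphalf n) n.-1) Ss = config w (uphalf n) n.-1
    & forall i, i <= w ->
      config i (uphalf n) n.-1 \in config 0 (uphalf n) n.-1 :: Ss].
Proof.
elim: w => [|w IH] wn.
  by exists [::]; split=> // i; rewrite leqn0 => /eqP->; rewrite inE.
have [Ss [pSs lSs mSs]] := IH (ltnW wn); have [Ts pTs lTs] := config_rotate wn.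
exists (Ss ++ Ts); rewrite cat_path last_cat pSs lSs; split=> // i.
rewrite leq_eqVlt -cat_cons mem_cat => /predU1P[->|/mSs->//].
have := mem_last (config w (uphalf n) n.-1) Ts; rewrite lTs inE.
by case/predU1P=> [->|->]; rewrite ?orbT // mSs.
Qed.

Lemma config_mobile : mobile_general_position (config 0 (uphalf n) n.-1).
Proof.
have n1 : n.-1 < n by lia.
split; first by apply: config_general_position; lia.
have [Ss [pSs _ mSs]] := config_tour n1; exists Ss; split=> // x.
(* A leaf is occupied when the window starts at it, a cycle vertex when the window starts just after
   it, at offset [n.-1]. *)
pose w := if is_leaf x then position x else
  if (position x).+1 == n then 0 else (position x).+1.
have wn : w < n.
  rewrite /w; have := position_lt x.
  by case: (is_leaf x); last case: ifP => /eqP; lia.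
exists (config w (uphalf n) n.-1); first by apply: mSs; lia.
rewrite inE; have := offsetE wn (position_lt x); move: (offset _ _) => o.
rewrite /w; have := position_lt x.
by case: (is_leaf x); last case: ifP => /eqP; lia.
Qed.

Lemma card_config : uphalf n + 1 <= #|config 0 (uphalf n) n.-1|.
Proof.
have n0 : 0 < n by lia.
have n1 : n.-1 < n by lia.
(* The last index gives the cycle robot, the others the leaves. The default of [insubd] is never
   taken, since [k < uphalf n] implies [k < n]. *)
pose f (k : 'I_(uphalf n + 1)) : sun :=
  if k < uphalf n then inr (insubd (Ordinal n0) (k : nat), ord0)
  else inl (Ordinal n1).
have fl k : is_leaf (f k) = (k < uphalf n) by rewrite /f; case: ifP.
have fp k : position (f k) = if k < uphalf n then k : nat else n.-1.
  rewrite /f; case: ifP => //= km; rewrite val_insubd; case: ifP => //; lia.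
have f_inj : injective f.
  move=> k l fkl; apply: val_inj => /=.
  have := fl k; have := fp k; rewrite fkl fl fp.
  by have := ltn_ord k; have := ltn_ord l; do 2?case: ifP; lia.
rewrite -[leqLHS]card_ord -(card_imset _ f_inj); apply/subset_leq_card/subsetP.
by move=> _ /imsetP[k _ ->]; rewrite inE fl fp /offset leq0n subn0; case: (ltnP k).
Qed.

End SunGraph.

Theorem theorem4p3 (n : nat) (hn : 3 <= n) :
  mob (corona (cycle_graph n) (complete_graph 1)) = uphalf n + 1.
Proof.
apply/eqP; rewrite eqn_leq; apply/andP; split.
  by apply/bigmax_leqP => S /asboolP; apply: mobile_card_le.
apply: leq_trans (card_config hn) _.
by apply: leq_bigmax_cond; apply/asboolP; apply: config_mobile.
Qed.
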